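(* Let $(X,d)$ be a compact metric space and let $R_{\mathfrak X}=(X_j,f_j)_{1\le j\le n}$ be a local IFS on $X$ with (non-empty) local attractor $A_{\mathfrak X}$. Then: (1) if $A_0\supseteq A_{\mathfrak X}$ is a closed subset of $X$ with $F_{\mathfrak X}(A_0)\subseteq A_0$, then $A_{\mathfrak X}=\bigcap_{i\ge 0}F_{\mathfrak X}^i(A_0)$; (2) $A_{\mathfrak X}$ is a compact set and $A_{\mathfrak X}=\lim_{i\to\infty}F_{\mathfrak X}^i(X)$ with respect to the Hausdorff-Pompeiu distance; (3) $\emptyset\ne\mathcal B_{\mathfrak X}^{\,\mathrm{inv}}\subseteq\mathcal B_{\mathfrak X}^{\,\mathrm{out}}\subseteq\mathcal B_{\mathfrak X}\subseteq K^*(X)$.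
   Context: A local IFS on a compact metric space $(X,d)$ is a family $R_{\mathfrak X}=(X_j,f_j)_{1\le j\le n}$ with $n\ge 2$, where $X_1,\dots,X_n$ are arbitrary closed subsets of $X$ and each $f_j:X_j\to X$ is continuous. The local Hutchinson-Barnsley operator $F_{\mathfrak X}:2^X\to 2^X$ on the family $2^X$ of all subsets of $X$ is $F_{\mathfrak X}(B)=\bigcup_{1\le j\le n}f_j(B\cap X_j)$, and $F_{\mathfrak X}^i$ is its $i$-th iterate. A set $B\subseteq X$ is $F_{\mathfrak X}$-invariant if $F_{\mathfrak X}(B)=B$. There is a largest (for inclusion) $F_{\mathfrak X}$-invariant set, denoted $A_{\mathfrak X}$; it is the union of all $F_{\mathfrak X}$-invariant sets. When $A_{\mathfrak X}\neq\emptyset$ it is called the local attractor of $R_{\mathfrak X}$. $K^*(X)$ is the family of non-empty compact subsets of $X$, with the Hausdorff-Pompeiu distance $\mathrm{dist}_H(A,B)=\max\{\max_{a\in A}d(a,B),\max_{b\in B}d(b,A)\}$. Limits of sets are taken in $(K^*(X),\mathrm{dist}_H)$ (so the sets involved are in particular non-empty). Define $\mathcal B_{\mathfrak X}^{\,\mathrm{inv}}=\{A_0\in K^*(X): F_{\mathfrak X}(A_0)\subseteq A_0 \text{ and } A_{\mathfrak X}\subseteq A_0\}$, $\mathcal B_{\mathfrak X}^{\,\mathrm{out}}=\{A_0\in K^*(X): \bigcap_{i\ge0}F_{\mathfrak X}^i(A_0)=A_{\mathfrak X}\}$, $\mathcal B_{\mathfrak X}=\{A_0\in K^*(X): \lim_{i\to\infty}F_{\mathfrak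 X}^i(A_0)=A_{\mathfrak X}\}$. *)

(* Defs.v *)
From mathcomp Require Import all_boot all_order all_algebra.
From mathcomp Require Import all_classical reals topology normedtype.

Set Implicit Arguments.
Unset Strict Implicit.
Unset Printing Implicit Defensive.

Import Order.TTheory GRing.Theory Num.Theory.
Import numFieldNormedType.Exports.

Local Open Scope classical_set_scope.
Local Open Scope ring_scope.

(* [lifs_map j] is a total function, but only its values on [lifs_dom j] are
   constrained or used: it stands for the map f_j : X_j -> X.  The sets
   [lifs_dom j] may overlap, be empty, or fail to cover the space. *)
Record local_ifs (T : topologicalType) (n : nat) := LocalIFS {
  lifs_dom : 'I_n -> set T;
  lifs_map : 'I_n -> T -> T;
  lifs_size : (2 <= n)%N;
  lifs_closed : forall j, closed (lifs_dom j);
  lifs_continuous : forall j, {within lifs_dom j, continuous (lifs_map j)}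
}.

Section Operator.
Context {T : topologicalType} {n : nat} (S : local_ifs T n).

Definition hutchinson (B : set T) : set T :=
  \bigcup_(j in [set: 'I_n]) (lifs_map S j @` (B `&` lifs_dom S j)).

Definition invariant_set (B : set T) : Prop := hutchinson B = B.

Definition local_attractor : set T := \bigcup_(B in invariant_set) B.

Lemma hutchinsonS (A B : set T) :
  A `<=` B -> hutchinson A `<=` hutchinson B.
Proof.
move=> AB y [j _ [x [Ax jx] <-]]; exists j => //.
by exists x => //; split=> //; exact: AB.
Qed.

Lemma local_attractor_max (B : set T) :
  invariant_set B -> B `<=` local_attractor.
Proof. by move=> FB x Bx; exists B. Qed.

Lemma local_attractor_invariant : invariant_set local_attractor.
Proof.
have FS B : invariant_set B -> B `<=` hutchinson local_attractor.
  by move=> FB; rewrite -[B in B `<=` _]FB; apply/hutchinsonS/local_attractor_max.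
apply/seteqP; split=> [y [j _ [x [[B FB Bx] jx] <-]]|y [B FB By]].
  exists B => //; rewrite -FB; exists j => //; exists x => //; by split.
exact: FS By.
Qed.

End Operator.

Section HausdorffPompeiu.
Context {R : realType} {T : metricType R}.

(* K^*(X) *)
Definition hyperspace : set (set T) := [set A | A !=set0 /\ compact A].

Definition set_dist (a : T) (B : set T) : R := inf [set mdist a b | b in B].

(* [inf] and [sup] over the reals take the default value 0 on sets that are
   empty or unbounded; these cases do not arise for members of [hyperspace],
   where the supremum below is moreover attained. *)
Definition excess (A B : set T) : R := sup [set set_dist a B | a in A].

Definition hausdorff_dist (A B : set T) : R :=
  Num.max (excess A B) (excess B A).

(* Convergence in (K^*(X), dist_H): membership in [hyperspace] of the terms and
   of the limit is part of the definition. *)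
Definition hausdorff_cvg (u : nat -> set T) (A : set T) : Prop :=
  [/\ forall i, hyperspace (u i), hyperspace A &
      hausdorff_dist (u i) A @[i --> \oo] --> (0 : R)].

End HausdorffPompeiu.

Section Basins.
Context {R : realType} {T : metricType R} {n : nat} (S : local_ifs T n).

Local Notation F := (hutchinson S).

Definition basin_inv : set (set T) :=
  [set A0 | [/\ hyperspace A0, F A0 `<=` A0 & local_attractor S `<=` A0]].

Definition basin_out : set (set T) :=
  [set A0 | hyperspace A0 /\ \bigcap_i iter i F A0 = local_attractor S].

Definition basin : set (set T) :=
  [set A0 | hyperspace A0 /\
            hausdorff_cvg (fun i => iter i F A0) (local_attractor S)].

End Basins.

(* Main.v *)
Require Import Defs.
From mathcomp Require Import all_boot all_order all_algebra.
From mathcomp Require Import all_classical reals topology normedtype.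

Local Open Scope classical_set_scope.
Local Open Scope ring_scope.

Import Order.TTheory GRing.Theory Num.Theory.
Import numFieldNormedType.Exports.

(** Write F for the Hutchinson-Barnsley operator and A for the largest
    F-invariant set.  Compactness of the space makes F preserve closed sets, and
    makes F commute with the intersection L of a decreasing sequence of closed
    sets K_i: the points that some f_j sends to a given y form a closed set,
    and if y lies in every F(K_i), this closed set meets every K_i, hence
    meets L ([bigcap_hutchinson_sub]).

    Let A0 be a closed set with F(A0) contained in A0.  Its iterates F^i(A0)
    are closed and decreasing, so their intersection is invariant and is
    therefore contained in A; if moreover A0 contains A, then so does
    F^i(A0) for each i.  Hence the intersection equals A
    ([bigcap_iter_hutchinson]).  Taking A0 to be the whole space X shows that A
    is compact.

    For the convergence, any sequence of compact sets squeezed between A and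
    F^i(X) tends to A: the open e-neighbourhood of A contains the intersection of
    the F^i(X), hence contains F^i(X) for all large i
    ([near_sub_of_bigcap_sub]).  If A0 is a compact set whose iterates merely
    intersect in A, then F^i(A0) contains A and is contained in F^i(X) by
    monotonicity, so the squeeze applies although F^i(A0) need not be
    decreasing. *)

(** * Decreasing sequences of closed sets *)

Lemma bigcap_closed_nonempty (T : topologicalType) (K : nat -> set T) :
  compact [set: T] -> (forall i, closed (K i)) ->
  {homo K : i j / (i <= j)%N >-> j `<=` i} -> (forall i, K i !=set0) ->
  \bigcap_i K i !=set0.
Proof.
move=> cT Kcl Kdec K0.
have KF : ProperFilter (filter_from [set: nat] K).
  apply: filter_from_proper => [|i _]; last exact: K0.
  apply: filter_from_filter => [|i j _ _]; first by exists 0%N.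
  exists (maxn i j) => //.
  by rewrite subsetI; split; apply: Kdec; rewrite ?leq_maxl ?leq_maxr.
have [|x [_ clx]] := cT _ KF; first by exists 0%N.
exists x => i _; apply: Kcl => B xB.
by apply: clx => //; exists i.
Qed.

Lemma near_sub_of_bigcap_sub (T : topologicalType) (K : nat -> set T)
    (U : set T) :
  compact [set: T] -> (forall i, closed (K i)) ->
  {homo K : i j / (i <= j)%N >-> j `<=` i} -> open U ->
  \bigcap_i K i `<=` U -> \forall i \near \oo, K i `<=` U.
Proof.
move=> cT Kcl Kdec oU KU.
suff [N KNU] : exists N, K N `<=` U.
  by exists N => // i /= Ni; apply: subset_trans KNU; exact: Kdec.
apply: contrapT => /forallNP KnU.
have [||i|x xKU] := @bigcap_closed_nonempty T (fun i => K i `&` ~` U) cT.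
- by move=> i; apply: closedI => //; exact: open_closedC.
- by move=> i j ij; apply: setSI; exact: Kdec.
- by apply/set0P/eqP => /disjoints_subset; rewrite setCK; exact: KnU.
- have Ux : U x by apply: KU => i _; have [] := xKU i Logic.I.
  by have [_] := xKU 0%N Logic.I.
Qed.

(** * The Hutchinson-Barnsley operator on a compact space *)

Lemma hutchinson_closed (T : topologicalType) (n : nat) (S : local_ifs T n)
    (B : set T) :
  hausdorff_space T -> compact [set: T] -> closed B ->
  closed (hutchinson S B).
Proof.
move=> hT cT Bcl; apply: closed_bigcup => [|j _]; first exact: finite_finset.
apply: compact_closed => //; apply: continuous_compact.
  exact: continuous_subspaceW (@subIsetr _ _ _) (@lifs_continuous _ _ S j).
apply: (subclosed_compact _ cT) => //.
by apply: closedI => //; exact: lifs_closed.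
Qed.

Lemma hutchinson_fiber_closed (T : topologicalType) (n : nat)
    (S : local_ifs T n) (y : T) :
  hausdorff_space T ->
  closed (\bigcup_(j in [set: 'I_n])
    (lifs_dom S j `&` lifs_map S j @^-1` [set y])).
Proof.
move=> hT; apply: closed_bigcup => [|j _]; first exact: finite_finset.
have /continuous_closedP fcl := @lifs_continuous _ _ S j.
rewrite closed_setSI; last exact: lifs_closed.
by apply: fcl; apply: accessible_closed_set1; exact: hausdorff_accessible.
Qed.

Lemma bigcap_hutchinson_sub (T : topologicalType) (n : nat)
    (S : local_ifs T n) (K : nat -> set T) :
  hausdorff_space T -> compact [set: T] -> (forall i, closed (K i)) ->
  {homo K : i j / (i <= j)%N >-> j `<=` i} ->
  \bigcap_i hutchinson S (K i) `<=` hutchinson S (\bigcap_i K i).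
Proof.
move=> hT cT Kcl Kdec y Fy.
pose P := \bigcup_(j in [set: 'I_n])
  (lifs_dom S j `&` lifs_map S j @^-1` [set y]).
have [||i|x PKx] := @bigcap_closed_nonempty T (fun i => K i `&` P) cT.
- by move=> i; apply: closedI => //; exact: hutchinson_fiber_closed.
- by move=> i j ij; apply: setSI; exact: Kdec.
- have [j _ [x [Kx jx] fx]] := Fy i Logic.I.
  by exists x; split=> //; exists j.
- have [_ [j _ [jx fx]]] := PKx 0%N Logic.I.
  exists j => //; exists x => //; split=> // i _.
  by have [] := PKx i Logic.I.
Qed.

Lemma iter_hutchinsonS (T : topologicalType) (n : nat) (S : local_ifs T n)
    (A B : set T) (i : nat) :
  A `<=` B -> iter i (hutchinson S) A `<=` iter i (hutchinson S) B.
Proof. by move=> AB; elim: i => //= i IH; exact: hutchinsonS. Qed.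

Lemma iter_hutchinson_closed (T : topologicalType) (n : nat)
    (S : local_ifs T n) (B : set T) (i : nat) :
  hausdorff_space T -> compact [set: T] -> closed B ->
  closed (iter i (hutchinson S) B).
Proof. by move=> hT cT Bcl; elim: i => //= i IH; exact: hutchinson_closed. Qed.

Lemma iter_hutchinson_decreasing (T : topologicalType) (n : nat)
    (S : local_ifs T n) (B : set T) :
  hutchinson S B `<=` B ->
  {homo (fun i => iter i (hutchinson S) B) : i j / (i <= j)%N >-> j `<=` i}.
Proof.
move=> FB i j /subnK <-; rewrite addnC iterD.
apply: iter_hutchinsonS; elim: (j - i)%N => //= k IH.
by apply: subset_trans FB; exact: hutchinsonS.
Qed.

Lemma local_attractor_sub_iter (T : topologicalType) (n : nat)
    (S : local_ifs T n) (B : set T) (i : nat) :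
  local_attractor S `<=` B -> local_attractor S `<=` iter i (hutchinson S) B.
Proof.
move=> AB; elim: i => //= i IH.
by rewrite -(local_attractor_invariant S); exact: hutchinsonS.
Qed.

Lemma bigcap_iter_hutchinson (T : topologicalType) (n : nat)
    (S : local_ifs T n) (B : set T) :
  hausdorff_space T -> compact [set: T] -> closed B ->
  hutchinson S B `<=` B -> local_attractor S `<=` B ->
  \bigcap_i iter i (hutchinson S) B = local_attractor S.
Proof.
move=> hT cT Bcl FB AB; apply/seteqP; split; last first.
  by move=> x Ax i _; exact: local_attractor_sub_iter Ax.
apply: local_attractor_max; apply/seteqP; split.
- move=> y [j _ [x [xB jx] <-]] i _.
  (* the iterates decrease, so it is enough to reach the next one *)
  apply: (iter_hutchinson_decreasing _ _ _ _ FB _ _ (leqnSn i)) => /=.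
  by exists j => //; exists x => //; split=> //; exact: xB.
- move=> y yB; apply: bigcap_hutchinson_sub => //.
  + by move=> i; exact: iter_hutchinson_closed.
  + exact: iter_hutchinson_decreasing.
  + by move=> i _; exact: (yB i.+1).
Qed.

(** * Hausdorff-Pompeiu estimates *)

Lemma set_dist_le (R : realType) (T : metricType R) (a b : T) (B : set T) :
  B b -> set_dist a B <= mdist a b.
Proof.
move=> Bb; apply: ge_inf; last by exists b.
by exists 0 => _ [c _ <-]; exact: mdist_ge0.
Qed.

Lemma excess_le (R : realType) (T : metricType R) (A B : set T) (e : R) :
  A !=set0 -> (forall a, A a -> exists2 b, B b & mdist a b <= e) ->
  excess A B <= e.
Proof.
move=> [a0 Aa0] AB; apply: ge_sup; first by exists (set_dist a0 B), a0.
by move=> _ [a /AB[b Bb abe] <-]; apply: le_trans abe; exact: set_dist_le.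
Qed.

Lemma excess_sub (R : realType) (T : metricType R) (A B : set T) :
  A !=set0 -> A `<=` B -> excess A B = 0.
Proof.
move=> A0 AB; rewrite /excess -[RHS]sup1; congr sup.
have d0 a : A a -> set_dist a B = 0.
  move=> /AB Ba; apply/eqP; rewrite eq_le; apply/andP; split.
    by rewrite -(mdistxx a); exact: set_dist_le.
  apply: lb_le_inf; first by exists (mdist a a), a.
  by move=> _ [b _ <-]; exact: mdist_ge0.
apply/seteqP; split=> [_ [a Aa <-]|_ ->]; first exact: d0.
by have [a Aa] := A0; exists a => //; exact: d0.
Qed.

(** Compact sets squeezed between a decreasing sequence of closed sets and its
    non-empty intersection A converge to A; nothing is asked of their
    monotonicity. *)
Lemma hausdorff_cvg_squeeze (R : realType) (T : metricType R)
    (u K : nat -> set T) (A : set T) :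
  compact [set: T] -> A !=set0 -> (forall i, compact (u i)) ->
  (forall i, closed (K i)) -> {homo K : i j / (i <= j)%N >-> j `<=` i} ->
  \bigcap_i K i = A -> (forall i, A `<=` u i) -> (forall i, u i `<=` K i) ->
  hausdorff_cvg u A.
Proof.
move=> cT A0 uco Kcl Kdec KA Au uK.
have u0 i : u i !=set0 by exact: subset_nonempty A0.
have Aco : compact A.
  by rewrite -KA; apply: (subclosed_compact _ cT) => //; exact: closed_bigI.
split=> //.
apply/cvgrPdist_le => e e0.
pose U := \bigcup_(a in A) [set x | (ball a e)° x].
have oU : open U by apply: bigcup_open => a _; exact: open_interior.
have AU : A `<=` U by move=> a Aa; exists a => //; exact: nbhsx_ballx.
have : \forall i \near \oo, K i `<=` U.
  by apply: near_sub_of_bigcap_sub => //; rewrite KA.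
apply: filterS => i KU.
rewrite sub0r normrN /hausdorff_dist [excess A _]excess_sub //.
rewrite ger0_norm ?le_max ?lexx ?orbT // ge_max (ltW e0) andbT.
apply: excess_le => // x /uK/KU[a Aa /interior_subset].
rewrite ballEmdist /= => axe; exists a => //.
by rewrite metric_sym ltW.
Qed.

Theorem theorem1 (R : realType) (T : metricType R) (n : nat)
    (S : local_ifs T n)
    (X_compact : compact [set: T])
    (attractor_nonempty : local_attractor S !=set0) :
  [/\ (forall A0 : set T,
         local_attractor S `<=` A0 -> closed A0 -> hutchinson S A0 `<=` A0 ->
         local_attractor S = \bigcap_i iter i (hutchinson S) A0),
      compact (local_attractor S) /\
      hausdorff_cvg (fun i => iter i (hutchinson S) [set: T])
        (local_attractor S)
    & [/\ basin_inv S !=set0,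
          basin_inv S `<=` basin_out S,
          basin_out S `<=` basin S
        & basin S `<=` hyperspace]].
Proof.
have hT : hausdorff_space T by exact: metric_hausdorff.
have KA : \bigcap_i iter i (hutchinson S) [set: T] = local_attractor S.
  by apply: bigcap_iter_hutchinson => //; exact: closedT.
have cvgA (A0 : set T) : closed A0 ->
    (forall i, local_attractor S `<=` iter i (hutchinson S) A0) ->
    hausdorff_cvg (fun i => iter i (hutchinson S) A0) (local_attractor S).
  move=> clA0 AA0.
  apply: (@hausdorff_cvg_squeeze R T _ (fun i => iter i (hutchinson S) setT))
    => // i.
  - apply: (subclosed_compact _ X_compact) => //.
    exact: iter_hutchinson_closed.
  - by apply: iter_hutchinson_closed => //; exact: closedT.
  - exact: iter_hutchinson_decreasing.
  - exact: iter_hutchinsonS.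
have cvgT : hausdorff_cvg (fun i => iter i (hutchinson S) setT)
    (local_attractor S).
  by apply: cvgA closedT _ => i; exact: local_attractor_sub_iter.
split.
- by move=> A0 AA0 clA0 FA0; rewrite bigcap_iter_hutchinson.
- by split=> //; have [_ []] := cvgT.
split.
- exists setT; split=> //; split=> //.
  by have [x _] := attractor_nonempty; exists x.
- move=> A0 [[ne coA0] FA0 AA0]; split=> //.
  by apply: bigcap_iter_hutchinson => //; exact: compact_closed.
- move=> A0 [[ne coA0] KA0]; split=> //.
  apply: cvgA => [|i]; first exact: compact_closed.
  by rewrite -KA0; exact: bigcap_inf.
- by move=> A0 [].
Qed.
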